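(* Let $G$ be a graph with exactly two (distinct) Seidel eigenvalues. If a Seidel eigenvalue of $G$ is not an integer, then $G$ is strongly maximal.
   Context: All graphs are finite, simple, undirected, without loops. The Seidel matrix of a graph $G$ is $S(G)=\mathbf{J}-\mathbf{I}-2A(G)$, where $A(G)$ is the adjacency matrix, $\mathbf{J}$ the all-ones matrix and $\mathbf{I}$ the identity matrix; equivalently, a Seidel matrix is a symmetric matrix with zero diagonal and all off-diagonal entries $\pm1$. Seidel eigenvalues of $G$ are the eigenvalues of $S(G)$. A Seidel matrix $S$ with largest eigenvalue $\lambda$ is strongly maximal if there is no Seidel matrix $S'$ such that the largest eigenvalue of $S'$ equals $\lambda$ and $S'$ contains $S$ as a proper principal submatrix. A graph $G$ is strongly maximal if $S(G)$ is. *)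

(* Defs.v *)
From HB Require Import structures.
From mathcomp Require Import all_boot all_order all_algebra.
From mathcomp Require Import reals.

Set Implicit Arguments.
Unset Strict Implicit.
Unset Printing Implicit Defensive.

Import Order.TTheory GRing.Theory Num.Theory.
Local Open Scope ring_scope.

(* A graph is a symmetric irreflexive relation [e] on a finite type [T] of
   vertices; its matrices are indexed by 'I_#|T| through [enum_val]. *)
Definition adjacency_matrix (R : realType) (T : finType) (e : rel T) :
    'M[R]_#|T| :=
  \matrix_(i, j) (e (enum_val i) (enum_val j))%:R.

Definition seidel_matrix (R : realType) (T : finType) (e : rel T) :
    'M[R]_#|T| :=
  const_mx 1 - 1%:M - 2%:R *: adjacency_matrix R e.

Definition is_seidel (R : realType) (n : nat) (S : 'M[R]_n) : Prop :=
  [/\ S^T = S,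
      forall i, S i i = 0
    & forall i j, i != j -> S i j = 1 \/ S i j = -1].

Definition largest_eigenvalue (R : realType) (n : nat) (S : 'M[R]_n)
    (l : R) : Prop :=
  eigenvalue S l /\ forall a, eigenvalue S a -> a <= l.

(* The rows and columns are selected by the same injection, which need not be
   increasing: containment is up to a simultaneous reordering of the rows and
   columns of [S']. *)
Definition proper_principal_submatrix (R : realType) (n m : nat)
    (S : 'M[R]_n) (S' : 'M[R]_m) : Prop :=
  (n < m)%N /\ exists f : 'I_n -> 'I_m, injective f /\ S = mxsub f f S'.

Definition strongly_maximal (R : realType) (n : nat) (S : 'M[R]_n) : Prop :=
  is_seidel S /\
  exists l : R,
    largest_eigenvalue S l /\
    ~ exists (m : nat) (S' : 'M[R]_m),
        [/\ is_seidel S', largest_eigenvalue S' l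
          & proper_principal_submatrix S S'].

Definition strongly_maximal_graph (R : realType) (T : finType) (e : rel T) :
    Prop :=
  strongly_maximal (seidel_matrix R e).

Definition two_eigenvalues (R : realType) (n : nat) (S : 'M[R]_n) : Prop :=
  exists a b : R, a != b /\ forall x, eigenvalue S x <-> x = a \/ x = b.

(* Main.v *)
Require Import Defs.
From HB Require Import structures.
From mathcomp Require Import all_boot all_order all_algebra.
From mathcomp Require Import reals.
From mathcomp Require Import spectral sesquilinear complex.

(** Let [a] be the largest and [b] the other eigenvalue of the Seidel matrix
    [S].  Being symmetric, [S] is diagonalisable, whence
    [(S - b) (S - a) = 0].  So every row of [S - b] is an [a]-eigenvector of [S]
    ([mulmx_two_eigenvalues]).

    Suppose that a Seidel matrix [S'] contains [S] properly and still has [a]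
    as largest eigenvalue.  An [a]-eigenvector [x] of [S], padded with zeros,
    makes the nonnegative quadratic form of [a - S'] vanish, so it is an
    eigenvector of [S'] ([principal_eigenvector_ext]).  Reading the eigenvector
    equation at an index [j] outside [S], where the padded vector is zero,
    gives [x *m v = 0], where [v] is the part of column [j] of [S'] indexed
    by [S].  Applied to the rows of [S - b] this says [S *m v = b *: v]
    ([new_column_eigenvector]).  The entries of [S] are integers and those of
    [v] are signs, so [b] is an integer.  An off-diagonal entry of
    [S *m S = (a + b) *: S - (a * b)%:M] shows that [a + b] is an integer
    ([two_eigenvalues_sum_int]), so [a] is one too.  Hence no such [S'] exists
    when one of [a], [b] is not an integer. *)

Set Implicit Arguments.
Unset Strict Implicit.
Unset Printing Implicit Defensive.

Import Order.TTheory GRing.Theory Num.Theory.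
Local Open Scope ring_scope.
Local Open Scope sesquilinear_scope.
Local Open Scope complex_scope.

(** * Real symmetric matrices *)

(** The diagonalising matrix is complex, because the spectral theorem used here
    is that of hermitian matrices; its diagonal is real, and its entries are
    eigenvalues of [A] over [R] because the rank of [A - a] does not change in
    the field extension from [R] to [R[i]]. *)
Lemma symmetric_spectral (R : rcfType) (n : nat) (A : 'M[R]_n) :
  A^T = A ->
  exists (P : 'M[R[i]]_n) (d : 'rV[R]_n),
    [/\ P \is unitarymx, forall i, eigenvalue A (d 0 i)
      & map_mx (real_complex R) A
        = P^t* *m diag_mx (map_mx (real_complex R) d) *m P].
Proof.
move=> symA; set B := map_mx _ A.
have Bherm : B \is hermsymmx.
  apply: realsym_hermsym.
    by apply/is_hermitianmxP; rewrite expr0 scale1r map_mx_id // map_trmx symA.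
  apply/mxOverP => i j; rewrite mxE.
  by apply/complex_realP; exists (A i j).
have PU := spectral_unitarymx B.
have Breal := hermitian_spectral_diag_real Bherm.
have := orthomx_spectralP (hermitian_normalmx Bherm).
rewrite invmx_unitary //.
set P := spectralmx B in PU *; set s := spectral_diag B in Breal *.
have -> : s = map_mx (real_complex R) (map_mx (@complex.Re R) s).
  apply/rowP => i; rewrite !mxE RRe_real //.
  exact: (mxOverP Breal).
set d := map_mx (@complex.Re R) s => BE.
exists P, d; split => // i.
rewrite -(eigenvalue_map (real_complex R)); apply/eigenvalueP; rewrite -/B.
exists (row i P).
  rewrite -row_mul BE !mulmxA (unitarymxP PU) mul1mx.
  by apply/rowP => j; rewrite mul_diag_mx !mxE.
apply/eqP => Pi0; have /rowP/(_ i) := row_mul i P (P^t*).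
by rewrite (unitarymxP PU) Pi0 mul0mx !mxE eqxx => /eqP; rewrite oner_eq0.
Qed.

(** Each diagonal entry of a diagonalisation of [A] is killed by one of the two
    factors. *)
Lemma mulmx_two_eigenvalues (R : rcfType) (n : nat) (A : 'M[R]_n) (a b : R) :
  A^T = A -> (forall c, eigenvalue A c -> c = a \/ c = b) ->
  (A - b%:M) *m (A - a%:M) = 0.
Proof.
move=> symA ab; have [P [d [PU dP AE]]] := symmetric_spectral symA.
have shift c : map_mx (real_complex R) (A - c%:M)
    = P^t* *m diag_mx (map_mx (real_complex R) (d - const_mx c)) *m P.
  rewrite !map_mxB AE map_const_mx map_scalar_mx linearB mulmxBr mulmxBl.
  by rewrite /= diag_const_mx scalar_mxC (mulmxKtV _ PU).
apply: (@map_mx_inj _ _ (real_complex R)).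
rewrite map_mxM map_mx0 !shift !mulmxA (mulmxtVK _ PU).
rewrite -(mulmxA (P^t*)) mulmx_diag.
set D := (X in diag_mx X); have -> : D = 0; last by rewrite linear0 mulmx0 mul0mx.
apply/rowP => i; rewrite !mxE -rmorphM /=.
by case: (ab _ (dP i)) => ->; rewrite subrr (mulr0, mul0r) rmorph0.
Qed.

(** When [l] is an upper bound for the eigenvalues of [A], the quadratic form
    of [l - A] is nonnegative, and a nonnegative quadratic form vanishes only
    on the kernel of its matrix: in the coordinates that diagonalise [A] it is
    a sum of nonnegative terms [(l - d i) * `|y i| ^+ 2]. *)
Lemma rayleigh_max_eigenvector (R : rcfType) (n : nat) (A : 'M[R]_n) (l : R)
    (x : 'rV[R]_n) :
  A^T = A -> (forall c, eigenvalue A c -> c <= l) ->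
  x *m A *m x^T = l *: (x *m x^T) -> x *m A = l *: x.
Proof.
move=> symA leAl xAx; have [P [d [PU dP AE]]] := symmetric_spectral symA.
pose z := map_mx (real_complex R) x.
pose D := diag_mx (map_mx (real_complex R) d).
have [y zE] : exists y, z = y *m P by exists (z *m P^t*); rewrite (mulmxKtV _ PU).
have zAE : z *m map_mx (real_complex R) A = y *m D *m P.
  by rewrite AE zE !mulmxA (mulmxtVK _ PU).
have ztE : map_mx (real_complex R) x^T = z^t*.
  apply/matrixP => i j; rewrite !mxE; apply/esym/conj_Creal.
  by apply/complex_realP; exists (x j i).
have sum0 : \sum_i ((l - d 0 i)%:C * `|y 0 i| ^+ 2) = 0.
  have /(congr1 (map_mx (real_complex R))) := xAx.
  rewrite map_mxZ !map_mxM ztE -/z zAE zE trmx_mul map_mxM !mulmxA.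
  rewrite !(mulmxtVK _ PU) => /matrixP/(_ 0 0); rewrite !mxE => /esym/eqP.
  rewrite -subr_eq0 mulr_sumr -sumrB => /eqP zAz; rewrite -[RHS]zAz.
  apply: eq_bigr => i _; rewrite mul_mx_diag !mxE normCK rmorphB mulrBl /=.
  by rewrite [y 0 i * _%:C]mulrC -!mulrA.
apply: (@map_mx_inj _ _ (real_complex R)).
rewrite map_mxM map_mxZ -/z zAE zE scalemxAl; congr (_ *m P).
apply/rowP => i; rewrite mul_mx_diag !mxE mulrC.
have /eqP := sum0; rewrite psumr_eq0 => [/allP/(_ i)|j _]; last first.
  by rewrite mulr_ge0 ?exprn_ge0 // lecR subr_ge0 leAl.
rewrite mem_index_enum => /(_ isT) /=.
rewrite mulf_eq0 sqrf_eq0 normr_eq0 => /orP[|/eqP->]; last by rewrite !mulr0.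
by rewrite rmorphB subr_eq0 => /eqP ->.
Qed.

(** * Principal submatrices *)

(** Padding with zeros preserves the value of the quadratic form and the norm,
    so an eigenvector of the submatrix for the largest eigenvalue [l] of the
    whole matrix still attains the maximum of the Rayleigh quotient. *)
Lemma principal_eigenvector_ext (R : rcfType) (n m : nat) (A : 'M[R]_m)
    (f : 'I_n -> 'I_m) (l : R) (x : 'rV[R]_n) (j : 'I_m) :
  A^T = A -> (forall c, eigenvalue A c -> c <= l) -> injective f ->
  x *m mxsub f f A = l *: x -> (forall i, f i != j) ->
  x *m (\col_i A (f i) j) = 0.
Proof.
move=> symA leAl finj xf fj.
(* right multiplication by [E] is the padding of a vector with zeros *)
pose E : 'M[R]_(n, m) := \matrix_(i, k) (f i == k)%:R.
have EA p (B : 'M_(m, p)) : E *m B = rowsub f B.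
  apply/matrixP => i k; rewrite !mxE (bigD1 (f i)) //= mxE eqxx mul1r big1.
    by rewrite addr0.
  by move=> t tfi; rewrite mxE eq_sym (negPf tfi) mul0r.
have EE : E *m E^T = 1%:M.
  by rewrite EA; apply/matrixP => i k; rewrite !mxE inj_eq // eq_sym.
have EAE : E *m A *m E^T = mxsub f f A.
  rewrite EA -[LHS]trmxK trmx_mul trmxK EA.
  by apply/matrixP => i k; rewrite !mxE.
have : (x *m E) *m A = l *: (x *m E).
  apply: rayleigh_max_eigenvector => //.
  rewrite trmx_mul !mulmxA -(mulmxA x E A) -(mulmxA x (E *m A)) EAE xf.
  by rewrite -(mulmxA x E) EE mulmx1 scalemxAl.
move/matrixP=> /(_ 0 j); rewrite -mulmxA EA => xAj.
apply/matrixP => i k; rewrite !ord1 {i k} mxE.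
transitivity ((x *m rowsub f A) 0 j).
  by rewrite mxE; apply: eq_bigr => i _; rewrite !mxE.
rewrite xAj !mxE big1 ?mulr0 // => i _.
by rewrite mxE (negPf (fj i)) mulr0.
Qed.

(** * Seidel matrices *)

Lemma seidel_matrix_is_seidel (R : realType) (T : finType) (e : rel T) :
  symmetric e -> irreflexive e -> is_seidel (seidel_matrix R e).
Proof.
move=> e_sym e_irr; split.
- by apply/matrixP => i j; rewrite !mxE e_sym [j == i]eq_sym.
- by move=> i; rewrite !mxE e_irr eqxx mulr0 subrr subr0.
- move=> i j /negPf ij; rewrite !mxE ij subr0.
  by case: (e _ _); [right | left]; rewrite ?mulr1 ?mulr0 ?subr0 // opprD addNKr.
Qed.

Section Seidel.

Variables (R : realType) (n : nat) (S : 'M[R]_n).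
Hypothesis S_seidel : is_seidel S.

Lemma seidel_int i j : S i j \is a Num.int.
Proof.
have [_ S0 S1] := S_seidel.
have [->|/S1[]->] := eqVneq i j; by rewrite ?S0 ?rpredN ?rpred1 ?rpred0.
Qed.

(** The diagonal part of [S *m S = (a + b) *: S - (a * b)%:M] does not see
    [a + b], but an off-diagonal entry of [S] is a sign. *)
Lemma two_eigenvalues_sum_int (a b : R) :
  a != b -> (forall x, eigenvalue S x <-> x = a \/ x = b) ->
  a + b \is a Num.int.
Proof.
move=> ab Sab; have [St S0 S1] := S_seidel.
have SS : S *m S = (a + b) *: S - (a * b)%:M.
  have := @mulmx_two_eigenvalues _ _ _ a b St (fun c => proj1 (Sab c)).
  rewrite mulmxBl !mulmxBr mul_mx_scalar !mul_scalar_mx scale_scalar_mx.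
  move/eqP; rewrite subr_eq0 subr_eq => /eqP ->.
  by rewrite addrAC -scalerDl [b + a]addrC [b * a]mulrC.
have [/existsP[i /existsP[j ij]]|noij] := boolP [exists i, exists j : 'I_n, i != j].
  have := congr1 (fun M : 'M_n => M i j) SS.
  rewrite !mxE (negPf ij) subr0.
  have Sij : S i j * S i j = 1 by case: (S1 _ _ ij) => ->; rewrite ?mulrNN mulr1.
  move/(congr1 ( *%R^~ (S i j))); rewrite -mulrA Sij mulr1 => <-.
  by rewrite rpredM ?seidel_int // rpred_sum // => k _; rewrite rpredM ?seidel_int.
(* the remaining matrices have at most one entry, which is zero *)
have S_eq0 : S = 0.
  apply/matrixP => i j; rewrite mxE.
  have [->|ij] := eqVneq i j; first exact: S0.
  by case/existsP: noij; exists i; apply/existsP; exists j.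
have eig0 c : eigenvalue S c -> c = 0.
  case/eigenvalueP=> v; rewrite S_eq0 mulmx0 => /esym/eqP.
  by rewrite scaler_eq0 => /orP[/eqP //|/eqP->]; rewrite eqxx.
have a0 : a = 0 by apply: eig0; apply: (proj2 (Sab a)); left.
have b0 : b = 0 by apply: eig0; apply: (proj2 (Sab b)); right.
by rewrite a0 b0 eqxx in ab.
Qed.

(** Every row of [S - b] is an [a]-eigenvector of [S], so it is orthogonal to
    the column that an extension with the same largest eigenvalue adds. *)
Lemma new_column_eigenvector (a b : R) (m : nat) (S' : 'M[R]_m)
    (f : 'I_n -> 'I_m) (j : 'I_m) :
  (forall c, eigenvalue S c -> c = a \/ c = b) ->
  S'^T = S' -> (forall c, eigenvalue S' c -> c <= a) ->
  injective f -> S = mxsub f f S' -> (forall i, f i != j) ->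
  S *m (\col_i S' (f i) j) = b *: \col_i S' (f i) j.
Proof.
move=> Sab S't leS' finj SE fj; have [St _ _] := S_seidel.
have SS0 := mulmx_two_eigenvalues St Sab.
set v := \col_i _.
suff : (S - b%:M) *m v = 0.
  by rewrite mulmxBl mul_scalar_mx => /eqP; rewrite subr_eq0 => /eqP.
apply/row_matrixP => i; rewrite row_mul row0.
apply: (principal_eigenvector_ext S't leS') => //; rewrite -SE.
apply/eqP; rewrite -subr_eq0 -mul_mx_scalar -mulmxBr.
by rewrite -row_mul SS0 row0.
Qed.

End Seidel.

Lemma seidel_two_eigenvalues_strongly_maximal (R : realType) (n : nat)
    (S : 'M[R]_n) :
  is_seidel S -> two_eigenvalues S ->
  (exists c : R, eigenvalue S c /\ c \isn't a Num.int) ->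
  strongly_maximal S.
Proof.
move=> S_seidel [a [b [ab Sab]]] [c [Sc cNint]]; split => //.
wlog lt_ba : a b ab Sab / b < a.
  move=> wlg; have [lt_ab|lt_ba|eq_ab] := ltgtP a b.
  - by apply: (wlg b a); rewrite 1?eq_sym // => x; rewrite Sab; split; case; auto.
  - exact: (wlg a b).
  - by rewrite eq_ab eqxx in ab.
have Sa : eigenvalue S a by apply/Sab; left.
exists a; split.
  by split=> // x /Sab[] -> //; apply: ltW.
case=> m [S' [S'_seidel [_ leS'] [lt_nm [f [finj SE]]]]].
have [S't _ S'1] := S'_seidel.
have [j fj] : exists j, forall i, f i != j.
  have : ~~ ([set: 'I_m] \subset codom f).
    apply: contraL lt_nm => /subset_leq_card.
    by rewrite cardsT !card_ord -leqNgt card_codom // card_ord.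
  case/subsetPn => j _ jf; exists j => i.
  by apply: contraNneq jf => <-; apply: codom_f.
have Sv := new_column_eigenvector S_seidel (fun x => proj1 (Sab x)) S't leS'
  finj SE fj.
case: n S S_seidel Sab Sc Sa f lt_nm finj SE fj Sv
  => [|n] S S_seidel Sab Sc Sa f lt_nm finj SE fj Sv.
  by case/eigenvalueP: Sa => x _; rewrite thinmx0 eqxx.
have b_int : b \is a Num.int.
  have v2 : S' (f 0) j * S' (f 0) j = 1.
    by case: (S'1 _ _ (fj 0)) => ->; rewrite ?mulrNN mulr1.
  have /matrixP/(_ 0 0) := Sv; rewrite !mxE => /(congr1 ( *%R^~ (S' (f 0) j))).
  rewrite -mulrA v2 mulr1 => <-.
  rewrite rpredM ?(seidel_int S'_seidel) // rpred_sum // => k _.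
  by rewrite mxE rpredM ?(seidel_int S_seidel) ?(seidel_int S'_seidel).
have a_int : a \is a Num.int.
  rewrite -[a](addrK b) rpredB //.
  exact: (two_eigenvalues_sum_int S_seidel ab Sab).
by case: (proj1 (Sab c) Sc) cNint => ->; rewrite ?a_int ?b_int.
Qed.

Theorem proposition6p6 (R : realType) (T : finType) (e : rel T)
    (e_sym : symmetric e) (e_irr : irreflexive e)
    (e_two : two_eigenvalues (seidel_matrix R e))
    (e_nonint : exists c : R,
        eigenvalue (seidel_matrix R e) c /\ c \isn't a Num.int) :
  strongly_maximal_graph R e.
Proof.
apply: seidel_two_eigenvalues_strongly_maximal => //.
exact: seidel_matrix_is_seidel.
Qed.
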